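(* Let $p,d,d_0,L,M,n,n_1$ be positive integers with $d\le p$, $d_0\le p$ and $n_1\le n-1$. Fix deterministic data $(x_1,y_1),\ldots,(x_n,y_n)\in\mathbb{R}^p\times\mathbb{R}$, a probability distribution $Q$ on $\mathcal{Q}_{p\times d}:=\{A\in\mathbb{R}^{p\times d}:\mathrm{diag}(A^TA)=(1,\ldots,1)^T\}$, a base regression method $\hat g\in\mathcal{G}_{d,n_1}$, and a matrix $A_0\in\mathbb{R}^{p\times d_0}$ with $A_0^TA_0=I_{d_0\times d_0}$. Run the random projection ensemble procedure described in the context, producing $\hat\Pi$ and $\hat A_0^{L}$, and let $\Pi^\infty:=\mathbb{E}\bigl(\mathbf{P}_{\ell,*}\mathbf{P}_{\ell,*}^T\bigr)$ (which does not depend on $\ell$). Then \[ \mathbb{E}\, d_{\mathrm{F}}\bigl(\mathcal{S}(\hat A_0^{L}),\mathcal{S}(A_0)\bigr)\le 2d_0^{1/2}\bigl\|\Pi^\infty-A_0A_0^T\bigr\|_{\mathrm{op}}+\frac{2d_0^{1/2}(2\pi)^{1/2}p}{L^{1/2}}, \] where all expectations are taken only over the randomness of the projections and of the subsamples (the data being fixed).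
   Context: A $d$-dimensional regression method on $n_1$ points is a measurable function $\hat g:\mathbb{R}^d\times(\mathbb{R}^d\times\mathbb{R})^{n_1}\to\mathbb{R}$; $\mathcal{G}_{d,n_1}$ denotes the set of all such functions. The procedure (random projection ensemble dimension reduction) is: draw $\mathbf{P}_{1,1},\ldots,\mathbf{P}_{L,M}$ i.i.d. from $Q$. For each $\ell\in[L]$, draw (independently of everything else) a subset $\mathcal{N}_1\subseteq\{1,\ldots,n\}$ of size $n_1$ uniformly at random without replacement; for each $m\in[M]$ and $i\notin\mathcal{N}_1$ set $\hat h_{\ell,m}(x_i)=\hat g\bigl(\mathbf{P}_{\ell,m}^Tx_i;(\mathbf{P}_{\ell,m}^Tx_j,y_j)_{j\in\mathcal{N}_1}\bigr)$ and $\hat R_{\ell,m}=\sum_{i\notin\mathcal{N}_1}\{y_i-\hat h_{\ell,m}(x_i)\}^2$; let $\mathbf{P}_{\ell,*}:=\mathbf{P}_{\ell,m^*}$ where $m^*$ is the smallest index minimising $\hat R_{\ell,m}$ over $m\in[M]$. Set $\hat\Pi:=\frac1L\sum_{\ell=1}^L\mathbf{P}_{\ell,*}\mathbf{P}_{\ell,*}^T$, compute its singular value decomposition $\hat\Pi=UDU^T$ with singular values in decreasing order and $U=(U_1,\ldots,U_p)$ orthonormal, and let $\hat A_0^{L}:=(U_1,\ldots,U_{d_0})\in\mathbb{R}^{p\times d_0}$. For a matrix $A$, $\mathcal{S}(A)$ is the span of its columns. For $\hat A,A\in\mathbb{R}^{p\times d_0}$ with orthonormal columns, $d_{\mathrm{F}}^2(\mathcal{S}(\hat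 A),\mathcal{S}(A)):=\frac12\|\hat A\hat A^T-AA^T\|_F^2$. $\|\cdot\|_{\mathrm{op}}$ is the spectral norm and $\|\cdot\|_F$ the Frobenius norm. *)

(* Defs.v *)
From HB Require Import structures.
From mathcomp Require Import all_boot all_order all_algebra.
From mathcomp Require Import all_classical all_reals all_analysis.
Unset Printing Implicit Defensive.
Import Order.TTheory GRing.Theory Num.Theory.
Local Open Scope classical_set_scope.
Local Open Scope ring_scope.

(* A type alias for matrices, equipped with the sigma-algebra generated by the
   coordinate maps A |-> A i j (i.e. the Borel sigma-algebra of R^{m x n}). *)
Definition mxT (R : realType) m n := 'M[R]_(m, n).
HB.instance Definition _ (R : realType) m n := Choice.on (mxT R m n).
HB.instance Definition _ (R : realType) m n := isPointed.Build (mxT R m n) 0.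
Definition mx_gen (R : realType) (m n : nat) : set (set (mxT R m n)) :=
  [set S | exists (i : 'I_m) (j : 'I_n) (B : set R),
     measurable B /\ S = (fun A : 'M[R]_(m, n) => A i j) @^-1` B].
Definition mxM (R : realType) m n := g_sigma_algebraType (mx_gen R m n).

Definition vnorm (R : realType) k (v : 'cV[R]_k) : R :=
  Num.sqrt (\sum_(i < k) v i 0 ^+ 2).
Definition opnorm (R : realType) m k (A : 'M[R]_(m, k)) : R :=
  sup [set vnorm R m (A *m v) | v in [set v : 'cV[R]_k | vnorm R k v = 1]].
Definition frobnorm (R : realType) m k (A : 'M[R]_(m, k)) : R :=
  Num.sqrt (\sum_(i < m) \sum_(j < k) A i j ^+ 2).
Definition dF (R : realType) p d0 (Ahat A : 'M[R]_(p, d0)) : R :=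
  Num.sqrt (2^-1 * frobnorm R p p (Ahat *m Ahat^T - A *m A^T) ^+ 2).

Definition unit_cols (R : realType) p d (A : 'M[R]_(p, d)) : Prop :=
  forall j : 'I_d, (A^T *m A) j j = 1.

(* Training sample (P^T x_j, y_j)_{j in N}, listed in increasing order of j,
   encoded as an n1 x (d+1) matrix whose k-th row is (P^T x_{j_k})^T, y_{j_k}. *)
Definition train (R : realType) p d n n1 (X : 'I_n -> 'cV[R]_p) (y : 'I_n -> R)
  (Pm : 'M[R]_(p, d)) (N : {set 'I_n}) : 'M[R]_(n1, d + 1) :=
  match enum N with
  | [::] => 0
  | i0 :: _ =>
      row_mx (\matrix_(k < n1, c < d) (Pm^T *m X (nth i0 (enum N) k)) c 0)
             (\col_(k < n1) y (nth i0 (enum N) k))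
  end.

Definition resid (R : realType) p d n n1
  (g : 'cV[R]_d -> 'M[R]_(n1, d + 1) -> R)
  (X : 'I_n -> 'cV[R]_p) (y : 'I_n -> R) (Pm : 'M[R]_(p, d)) (N : {set 'I_n}) : R :=
  \sum_(i < n | i \notin N) (y i - g (Pm^T *m X i) (train R p d n n1 X y Pm N)) ^+ 2.

Definition select_proj (R : realType) p d M (Ps : 'I_M -> 'M[R]_(p, d))
  (Rh : 'I_M -> R) : 'M[R]_(p, d) :=
  match [pick m : 'I_M | [forall m' : 'I_M, Rh m <= Rh m'] &&
                         [forall m' : 'I_M, (m' < m)%N ==> (Rh m < Rh m')]] with
  | Some m => Ps m
  | None => 0
  end.

Definition is_svd (R : realType) p (S U : 'M[R]_p) : Prop :=
  U^T *m U = 1%:M /\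
  exists D : 'rV[R]_p,
    (forall i, 0 <= D 0 i) /\
    (forall i j : 'I_p, (i <= j)%N -> D 0 j <= D 0 i) /\
    S = U *m diag_mx D *m U^T.

Definition mutual_indep d (Omega : measurableType d) (R : realType)
  (P : probability Omega R) (I : finType) (F : I -> set (set Omega)) : Prop :=
  forall (J : {set I}) (E : I -> set Omega),
    (forall i, i \in J -> F i (E i)) ->
    (P (\bigcap_(i in [set i | i \in J]) E i) = \prod_(i in J) P (E i))%E.

(* Main.v *)
(* Write T = A_0 A_0^T and let W be the projection onto the d_0 leading singular
   vectors of Pi_hat, so that d_F^2 = <T, T - W>. Ky Fan's maximum principle gives
   <Pi_hat, T - W> <= 0, hence
     d_F^2 <= <T - Pi_inf, T - W> + <Pi_inf - Pi_hat, T - W>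
           <= 2 d_0^(1/2) |Pi_inf - T|_op d_F + 2^(1/2) |Pi_hat - Pi_inf|_F d_F.
   No matrix concentration inequality is needed: Pi_hat is an average of L pairwise
   uncorrelated matrices with mean Pi_inf and Frobenius norm at most d almost surely,
   so E |Pi_hat - Pi_inf|_F^2 <= d^2 / L, and 2^(1/2) d <= 2 d_0^(1/2) (2 pi)^(1/2) p. *)

Require Import Defs.
From HB Require Import structures.
From mathcomp Require Import all_boot all_order all_algebra.
From mathcomp Require Import all_classical all_reals all_analysis.
From mathcomp Require Import measurable_realfun ring lra.
Import Order.TTheory GRing.Theory Num.Theory.
Local Open Scope classical_set_scope.
Local Open Scope ring_scope.

(** * Orthonormal frames and the Davis-Kahan bound *)

(** Ky Fan's inequality holds for every choice of leading singular vectors, ties included, so no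
    spectral gap of Pi_hat enters and d_F is bounded outcome by outcome. Passing to expectations
    meets several obstacles. The singular vectors are an arbitrary choice for each outcome, so d_F
    may fail to be measurable; it is dominated by a function of Pi_hat alone before anything is
    computed. That function is quadratic in |Pi_hat - Pi_inf|_F, so a second moment suffices. Unit
    columns hold only almost surely, so the moments are taken of a truncated copy of Pi_hat that is
    bounded everywhere. Finally, independence is given for single projections and subsets, whereas
    the average runs over groups of draws; each group is treated as one random element, and laws and
    independence are checked on the pi-system of rectangles. *)

Lemma mxtrace_trmulE (R : comNzRingType) m n (A B : 'M[R]_(m, n)) :
  \tr (A^T *m B) = \sum_i \sum_j A i j * B i j.
Proof.
rewrite /mxtrace exchange_big; apply: eq_bigr => j _; rewrite mxE.
by apply: eq_bigr => i _; rewrite mxE.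
Qed.

Lemma sqr_frobnorm (R : realType) m n (A : 'M[R]_(m, n)) :
  frobnorm R m n A ^+ 2 = \tr (A^T *m A).
Proof.
rewrite sqr_sqrtr ?mxtrace_trmulE //.
by apply: sumr_ge0 => i _; apply: sumr_ge0 => j _; exact: sqr_ge0.
Qed.

Lemma frobnorm_ge0 (R : realType) m n (A : 'M[R]_(m, n)) :
  0 <= frobnorm R m n A.
Proof. exact: sqrtr_ge0. Qed.

Lemma frobnorm_eq0 (R : realType) m n (A : 'M[R]_(m, n)) :
  frobnorm R m n A = 0 -> A = 0.
Proof.
move=> A0; have := sqr_frobnorm R m n A; rewrite A0 expr0n /= mxtrace_trmulE.
move=> /esym/eqP; rewrite psumr_eq0 => [/allP Z|i _]; last first.
  by apply: sumr_ge0 => j _; rewrite -expr2 sqr_ge0.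
apply/matrixP => i j; rewrite mxE; have := Z i (mem_index_enum i).
rewrite psumr_eq0 => [/allP/(_ j (mem_index_enum j))|k _] /=; last first.
  by rewrite -expr2 sqr_ge0.
by rewrite mulf_eq0 orbb => /eqP.
Qed.

(** With [a], [b] the two norms, expanding the square of the norm of [b *: A - a *: B] gives
    [2ab (ab - <A, B>)], and [2ab] can be cancelled once both norms are nonzero. *)
Lemma frobnorm_cauchy_schwarz (R : realType) m n (A B : 'M[R]_(m, n)) :
  \tr (A^T *m B) <= frobnorm R m n A * frobnorm R m n B.
Proof.
set a := frobnorm R m n A; set b := frobnorm R m n B.
have [a0|aN] := eqVneq a 0.
  by rewrite a0 mul0r (frobnorm_eq0 _ _ _ _ a0) trmx0 mul0mx mxtrace0.
have [b0|bN] := eqVneq b 0.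
  by rewrite b0 mulr0 (frobnorm_eq0 _ _ _ _ b0) mulmx0 mxtrace0.
have a_gt0 : 0 < a by rewrite lt_neqAle eq_sym aN frobnorm_ge0.
have b_gt0 : 0 < b by rewrite lt_neqAle eq_sym bN frobnorm_ge0.
have := sqr_ge0 (frobnorm R m n (b *: A - a *: B)).
have trB : (b *: A - a *: B)^T = b *: A^T - a *: B^T.
  by apply/matrixP => i j; rewrite !mxE.
rewrite sqr_frobnorm trB mulmxBl !mulmxBr -!scalemxAl -!scalemxAr.
rewrite !raddfB /= !mxtraceZ.
have -> : \tr (B^T *m A) = \tr (A^T *m B).
  by rewrite -mxtrace_tr trmx_mul trmxK.
rewrite -!sqr_frobnorm -/a -/b.
have -> : b * (b * a ^+ 2) - b * (a * \tr (A^T *m B)) +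
    (- (a * (b * \tr (A^T *m B))) - - (a * (a * b ^+ 2))) =
    (2 * (a * b)) * (a * b - \tr (A^T *m B)) by ring.
by rewrite pmulr_rge0 ?subr_ge0 // !mulr_gt0.
Qed.

Lemma frobnorm_tr (R : realType) m n (A : 'M[R]_(m, n)) :
  frobnorm R n m A^T = frobnorm R m n A.
Proof.
rewrite /frobnorm exchange_big; congr Num.sqrt.
by apply: eq_bigr => i _; apply: eq_bigr => j _; rewrite mxE.
Qed.

Lemma frobnormN (R : realType) m n (A : 'M[R]_(m, n)) :
  frobnorm R m n (- A) = frobnorm R m n A.
Proof.
congr Num.sqrt; apply: eq_bigr => i _; apply: eq_bigr => j _.
by rewrite mxE sqrrN.
Qed.

Lemma vnorm_frobnorm (R : realType) n (v : 'cV[R]_n) :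
  vnorm R n v = frobnorm R n 1 v.
Proof. by congr Num.sqrt; apply: eq_bigr => i _; rewrite big_ord1. Qed.

(** Cauchy-Schwarz bounds each squared entry of the product by a squared row norm times a squared
    column norm; these bounds sum to the product of the squared Frobenius norms. *)
Lemma frobnorm_mulmx (R : realType) m n k (A : 'M[R]_(m, n)) (B : 'M[R]_(n, k)) :
  frobnorm R m k (A *m B) <= frobnorm R m n A * frobnorm R n k B.
Proof.
rewrite -(@ler_pXn2r _ 2) ?nnegrE ?mulr_ge0 ?frobnorm_ge0 // exprMn.
rewrite sqr_frobnorm mxtrace_trmulE.
rewrite -(frobnorm_tr _ _ _ B) !sqr_frobnorm !mxtrace_trmulE mulr_suml.
apply: ler_sum => i _; rewrite mulr_sumr; apply: ler_sum => j _.
have -> : (A *m B) i j = \tr ((row i A) *m (col j B)).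
  by rewrite [LHS]mxE /mxtrace big_ord1 mxE; apply: eq_bigr => l _; rewrite !mxE.
rewrite -expr2 -(trmxK (row i A)).
have E1 : \sum_j0 A i j0 * A i j0 = frobnorm R n 1 (row i A)^T ^+ 2.
  rewrite sqr_frobnorm mxtrace_trmulE; apply: eq_bigr => l _.
  by rewrite big_ord1 !mxE.
have E2 : \sum_j0 B^T j j0 * B^T j j0 = frobnorm R n 1 (col j B) ^+ 2.
  rewrite sqr_frobnorm mxtrace_trmulE; apply: eq_bigr => l _.
  by rewrite big_ord1 !mxE.
rewrite E1 E2 -exprMn -[leLHS]real_normK ?num_real //.
rewrite ler_pXn2r ?nnegrE ?mulr_ge0 ?frobnorm_ge0 //.
rewrite ler_norml frobnorm_cauchy_schwarz andbT lerNl.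
rewrite -(frobnormN _ _ _ (col j B)).
apply: le_trans (frobnorm_cauchy_schwarz _ _ _ _ _).
by rewrite mulmxN raddfN.
Qed.

Lemma vnorm_le_opnorm (R : realType) m n (A : 'M[R]_(m, n)) (v : 'cV[R]_n) :
  vnorm R n v = 1 -> vnorm R m (A *m v) <= opnorm R m n A.
Proof.
move=> v1; apply: ub_le_sup; last by exists v.
exists (frobnorm R m n A) => _ [u /= u1 <-].
by rewrite vnorm_frobnorm -[leRHS]mulr1 -u1 vnorm_frobnorm frobnorm_mulmx.
Qed.

Lemma opnorm_ge0 (R : realType) m n (A : 'M[R]_(m, n)) : 0 <= opnorm R m n A.
Proof.
case: (pselect (exists v : 'cV[R]_n, vnorm R n v = 1)) => [[v v1]|noU].
  by apply: le_trans (vnorm_le_opnorm _ _ _ A v v1); exact: sqrtr_ge0.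
(* Without unit vectors the supremum is taken over the empty set, where [sup] is 0 by convention. *)
have E0 : [set vnorm R m (A *m v) | v in [set v | vnorm R n v = 1]] = set0.
  by rewrite -subset0 => x [v v1 _]; case: noU; exists v.
by rewrite /opnorm E0 sup0.
Qed.

(** The [k] columns of [B] are unit vectors, so each column of [A *m B] has norm at most [opnorm A].
    This is the origin of the factor d_0^(1/2). *)
Lemma frobnorm_mul_orthonormal (R : realType) m n k
    (A : 'M[R]_(m, n)) (B : 'M[R]_(n, k)) : B^T *m B = 1%:M ->
  frobnorm R m k (A *m B) <= Num.sqrt k%:R * opnorm R m n A.
Proof.
move=> B1; rewrite -(@ler_pXn2r _ 2) ?nnegrE ?mulr_ge0 ?sqrtr_ge0 ?opnorm_ge0 //.
rewrite sqr_frobnorm exprMn sqr_sqrtr ?ler0n // mxtrace_trmulE exchange_big /=.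
rewrite mulr_natl -[X in _ *+ X]card_ord -sumr_const; apply: ler_sum => j _.
have cj : vnorm R n (col j B) = 1.
  rewrite -[RHS]sqrtr1; congr Num.sqrt.
  have /matrixP/(_ j j) := B1; rewrite !mxE eqxx mulr1n => <-.
  by apply: eq_bigr => i _; rewrite !mxE expr2.
apply: le_trans (_ : vnorm R m (A *m col j B) ^+ 2 <= _); last first.
  by rewrite ler_pXn2r ?nnegrE ?sqrtr_ge0 ?opnorm_ge0 // vnorm_le_opnorm.
rewrite sqr_sqrtr ?sumr_ge0 // => [|i _]; last exact: sqr_ge0.
by apply: ler_sum => i _; rewrite colE mulmxA -colE [X in _ <= X ^+ 2]mxE.
Qed.

(** The projector [G = B B^T] satisfies [G i i = \sum_l G i l ^+ 2 >= G i i ^+ 2], and [G i i] is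
    the squared norm of row [i]. *)
Lemma orthonormal_row_le1 (R : realType) p k (B : 'M[R]_(p, k)) (i : 'I_p) :
  B^T *m B = 1%:M -> \sum_j B i j ^+ 2 <= 1.
Proof.
move=> B1; pose G := B *m B^T.
have Gi : G i i = \sum_j B i j ^+ 2.
  by rewrite mxE; apply: eq_bigr => j _; rewrite mxE expr2.
have GG : G *m G = G by rewrite /G mulmxA -(mulmxA B) B1 mulmx1.
have Gsym : G^T = G by rewrite trmx_mul trmxK.
have G2 : G i i ^+ 2 <= G i i.
  have Gii : G i i = \sum_l G i l * G l i by rewrite -[in LHS]GG mxE.
  rewrite [leRHS]Gii (bigD1 i) //= -expr2 lerDl sumr_ge0 // => l _.
  by have -> : G l i = G i l; rewrite -?expr2 ?sqr_ge0 // -[in LHS]Gsym [LHS]mxE.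
have Gi0 : 0 <= G i i by rewrite Gi sumr_ge0 // => j _; exact: sqr_ge0.
rewrite -Gi; have [G0|] := eqVneq (G i i) 0; first by rewrite G0.
rewrite neq_lt ltNge Gi0 /= => Gpos.
by rewrite -(ler_pM2l Gpos) mulr1 -expr2.
Qed.

(* Ky Fan's maximum principle. *)
Lemma mxtrace_svd_max (R : realType) p k (S U : 'M[R]_p) (A : 'M[R]_(p, k)) :
  (k <= p)%N -> is_svd R p S U -> A^T *m A = 1%:M ->
  \tr (A^T *m S *m A) <=
    \tr ((U *m pid_mx k : 'M[R]_(p, k))^T *m S *m (U *m pid_mx k)).
Proof.
move=> kp [U1 [D [D0 [Ddec ->]]]] A1.
have UU : U *m U^T = 1%:M by apply: mulmx1C.
have trD n (B : 'M[R]_(p, n)) :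
    \tr (B^T *m diag_mx D *m B) = \sum_i D 0 i * \sum_j B i j ^+ 2.
  rewrite -mulmxA mxtrace_trmulE; apply: eq_bigr => i _.
  rewrite mulr_sumr; apply: eq_bigr => j _.
  by rewrite mul_diag_mx mxE mulrCA expr2.
set B := U^T *m A.
have B1 : B^T *m B = 1%:M by rewrite trmx_mul trmxK mulmxA -(mulmxA A^T) UU mulmx1.
have -> : A^T *m (U *m diag_mx D *m U^T) *m A = B^T *m diag_mx D *m B.
  by rewrite trmx_mul trmxK !mulmxA.
set V := (U *m pid_mx k : 'M[R]_(p, k)).
have -> : V^T *m (U *m diag_mx D *m U^T) *m V =
    (pid_mx k : 'M[R]_(p, k))^T *m diag_mx D *m pid_mx k.
  rewrite /V trmx_mul !mulmxA -(mulmxA _ U^T) U1 mulmx1.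
  by rewrite -[_ *m U^T *m U]mulmxA U1 mulmx1.
rewrite !trD.
(* Both traces are now sums of singular values with weights in [0, 1] of total [k]: [b] for [A], and
   the indicator [e] of the first [k] indices for the leading vectors. *)
pose b i := \sum_j B i j ^+ 2; pose e (i : 'I_p) := (i < k)%N%:R : R.
have eE i : \sum_(j < k) (pid_mx k : 'M[R]_(p, k)) i j ^+ 2 = e i.
  rewrite /e; case: ltnP => ik; last first.
    by rewrite big1 // => j _; rewrite mxE andbC ltnNge ik expr0n.
  rewrite (bigD1 (Ordinal ik)) //= mxE eqxx ik expr1n big1 ?addr0 // => j jN.
  rewrite mxE (_ : (i == j :> nat) = false) ?expr0n //.
  by apply: contraNF jN => /eqP ij; apply/eqP/val_inj.
under [leRHS]eq_bigr => i _ do rewrite eE.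
rewrite -subr_ge0 -sumrB.
have [k0|k_gt0] := posnP k.
  rewrite big1 // => i _; rewrite /e [X in _ - _ * X]big1 => [|[j jk] _]; last first.
    by exfalso; move: jk; rewrite k0 ltn0.
  by rewrite (_ : (i < k)%N = false) ?mulr0 ?subr0 // k0 ltn0.
have kp' : (k.-1 < p)%N by rewrite prednK.
(* The [k]-th largest singular value, whence the separate case [k = 0]. As the weights have equal
   totals, [D] may be shifted by [c]; then [D 0 i - c] and [e i - b i] have the same sign on either
   side of [k]. *)
pose c := D 0 (Ordinal kp').
have sb : \sum_i b i = k%:R.
  have := mxtrace1 R k; rewrite -B1 mxtrace_trmulE => <-.
  by apply: eq_bigr => i _; apply: eq_bigr => j _; rewrite expr2.
have se : \sum_i e i = k%:R.
  have P1 : (pid_mx k : 'M[R]_(p, k))^T *m pid_mx k = 1%:M.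
    by rewrite tr_pid_mx mul_pid_mx minnn (minn_idPr kp) pid_mx_1.
  rewrite -(mxtrace1 R k) -P1 mxtrace_trmulE; apply: eq_bigr => i _.
  by rewrite -eE; apply: eq_bigr => j _; rewrite expr2.
have -> : \sum_i (D 0 i * e i - D 0 i * b i) = \sum_i (D 0 i - c) * (e i - b i).
  transitivity (\sum_i (D 0 i * e i - D 0 i * b i) -
                (c * \sum_i e i - c * \sum_i b i)).
    by rewrite sb se subrr subr0.
  rewrite !mulr_sumr -!sumrB; apply: eq_bigr => i _; ring.
apply: sumr_ge0 => i _; rewrite /e; have [ik|ik] := ltnP i k.
  apply: mulr_ge0; rewrite subr_ge0; last exact: orthonormal_row_le1.
  by apply: Ddec; rewrite /= -ltnS prednK.
rewrite sub0r mulrN -mulNr opprB mulr_ge0 //; last first.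
  by apply: sumr_ge0 => j _; exact: sqr_ge0.
by rewrite subr_ge0; apply: Ddec => /=; rewrite (leq_trans (leq_pred k)).
Qed.

Lemma sqr_dF_orthonormal (R : realType) p k (V A : 'M[R]_(p, k)) :
  V^T *m V = 1%:M -> A^T *m A = 1%:M ->
  dF R p k V A ^+ 2 = k%:R - \tr (A *m A^T *m (V *m V^T)).
Proof.
move=> V1 A1; have -> : dF R p k V A ^+ 2 = 2^-1 * frobnorm R p p (V *m V^T - A *m A^T) ^+ 2.
  by rewrite [LHS]sqr_sqrtr // mulr_ge0 ?sqr_ge0.
rewrite sqr_frobnorm.
have -> : (V *m V^T - A *m A^T)^T = V *m V^T - A *m A^T.
  by rewrite [LHS]raddfB /= !trmx_mul !trmxK.
rewrite mulmxBl !mulmxBr !raddfB /=.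
rewrite -(mulmxA V) (mulmxA V^T) V1 mul1mx -[X in - - \tr X]mulmxA (mulmxA A^T) A1.
rewrite mul1mx [\tr (V *m V^T *m _)]mxtrace_mulC.
rewrite (mxtrace_mulC V) V1 (mxtrace_mulC A A^T) A1 mxtrace1.
set t := \tr _; lra.
Qed.

(** Both sides are the sum of the squared sines of the principal angles: [1 - V V^T] is a symmetric
    idempotent, so the left side is [k - <A A^T, V V^T>]. *)
Lemma sqr_frobnorm_orth_compl (R : realType) p k (V A : 'M[R]_(p, k)) :
  V^T *m V = 1%:M -> A^T *m A = 1%:M ->
  frobnorm R p k ((1%:M - V *m V^T) *m A) ^+ 2 = dF R p k V A ^+ 2.
Proof.
move=> V1 A1; rewrite sqr_dF_orthonormal // sqr_frobnorm.
set W := V *m V^T.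
have WW : W *m W = W by rewrite /W mulmxA -(mulmxA V) V1 mulmx1.
have WT : W^T = W by rewrite trmx_mul trmxK.
have QT : (1%:M - W)^T = 1%:M - W by rewrite [LHS]raddfB /= trmx1 WT.
have QQ : (1%:M - W) *m (1%:M - W) = 1%:M - W.
  by rewrite mulmxBl mul1mx mulmxBr mulmx1 WW subrr subr0.
have -> : ((1%:M - W) *m A)^T *m ((1%:M - W) *m A) = A^T *m A - A^T *m W *m A.
  rewrite trmx_mul QT mulmxA -(mulmxA A^T (1%:M - W)) QQ.
  by rewrite mulmxBr mulmx1 mulmxBl.
by rewrite raddfB /= A1 mxtrace1 [\tr (A^T *m W *m A)]mxtrace_mulC mulmxA.
Qed.

Lemma dF_sym (R : realType) p k (V A : 'M[R]_(p, k)) : dF R p k V A = dF R p k A V.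
Proof. by rewrite /dF -(frobnormN _ _ _ (_ - _)) opprB. Qed.

Lemma mxtrace_orth_compl_le (R : realType) p k (Delta : 'M[R]_p)
    (V A : 'M[R]_(p, k)) :
  V^T *m V = 1%:M -> A^T *m A = 1%:M ->
  \tr (A^T *m (1%:M - V *m V^T) *m Delta *m A) <=
    dF R p k V A * (Num.sqrt k%:R * opnorm R p p Delta).
Proof.
move=> V1 A1; set W := V *m V^T.
have WT : (1%:M - W)^T = 1%:M - W by rewrite raddfB /= trmx1 /W trmx_mul trmxK.
have -> : A^T *m (1%:M - W) *m Delta *m A =
    ((1%:M - W) *m A)^T *m (Delta *m A) by rewrite trmx_mul WT !mulmxA.
apply: le_trans (frobnorm_cauchy_schwarz _ _ _ _ _) _.
have -> : frobnorm R p k ((1%:M - W) *m A) = dF R p k V A.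
  apply/eqP; rewrite -(@eqrXn2 _ 2) ?frobnorm_ge0 ?sqrtr_ge0 //.
  by rewrite sqr_frobnorm_orth_compl.
by rewrite ler_wpM2l ?sqrtr_ge0 ?frobnorm_mul_orthonormal.
Qed.

(* A variant of the Davis-Kahan theorem: with W = V V^T and T = A A^T,
   dF^2 = <T, T - W> <= <T - S, T - W> by Ky Fan, and T - S is split at Pi.
   The part T - Pi is handled with T - W = T (1 - W) - (1 - T) W, which gives
   the operator norm of T - Pi without using its spectral decomposition. *)
Lemma dF_svd_le (R : realType) p k (S Pi U : 'M[R]_p) (A : 'M[R]_(p, k)) :
  (k <= p)%N -> is_svd R p S U -> A^T *m A = 1%:M -> Pi^T = Pi ->
  dF R p k (U *m pid_mx k) A <=
    2 * Num.sqrt k%:R * opnorm R p p (Pi - A *m A^T) +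
    Num.sqrt 2 * frobnorm R p p (S - Pi).
Proof.
move=> kp svdU A1 PiT; have [UU _] := svdU.
set V := (U *m pid_mx k : 'M[R]_(p, k)).
have V1 : V^T *m V = 1%:M.
  rewrite /V trmx_mul mulmxA -(mulmxA _ U^T) UU mulmx1 tr_pid_mx mul_pid_mx.
  by rewrite minnn (minn_idPr kp) pid_mx_1.
set K := (X in _ <= X); set x := dF R p k V A.
have x0 : 0 <= x by exact: sqrtr_ge0.
have K0 : 0 <= K by rewrite addr_ge0 ?mulr_ge0 ?sqrtr_ge0 ?opnorm_ge0 ?frobnorm_ge0.
(* Every upper bound below carries one factor [x], which is cancelled here. *)
suff : x * x <= K * x.
  have [->//|xN] := eqVneq x 0; rewrite ler_pM2r // lt_neqAle x0 andbT eq_sym //.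
have KF := mxtrace_svd_max _ _ _ S U A kp svdU A1; rewrite -/V in KF.
clearbody V.
pose T := A *m A^T; pose W := V *m V^T.
have TT : T *m T = T by rewrite /T mulmxA -(mulmxA A) A1 mulmx1.
have TtT : T^T = T by rewrite /T trmx_mul trmxK.
have WtT : W^T = W by rewrite /W trmx_mul trmxK.
(* The same estimate with the two frames exchanged; together they produce the factor 2 before the
   operator norm. *)
have D1 := mxtrace_orth_compl_le _ _ _ (Pi - T) A V A1 V1.
have D2 := mxtrace_orth_compl_le _ _ _ (T - Pi) V A V1 A1.
have opN : opnorm R p p (T - Pi) = opnorm R p p (Pi - T).
  rewrite /opnorm; congr sup; congr image; apply/funext => v.
  by rewrite !vnorm_frobnorm -(frobnormN _ _ _ (_ *m v)) -mulNmx opprB.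
have F1 : \tr ((Pi - S) *m (T - W)) <= frobnorm R p p (S - Pi) * (Num.sqrt 2 * x).
  have -> : frobnorm R p p (S - Pi) = frobnorm R p p (Pi - S)^T.
    by rewrite frobnorm_tr -frobnormN opprB.
  have -> : Num.sqrt 2 * x = frobnorm R p p (T - W).
    rewrite /x dF_sym /dF -/T -/W -sqrtrM ?ler0n // mulrA divff ?mul1r ?pnatr_eq0 //.
    by rewrite sqrtr_sqr ger0_norm ?frobnorm_ge0.
  by rewrite -[X in \tr (X *m _)]trmxK frobnorm_cauchy_schwarz.
have E1 : x * x = \tr (T *m (T - W)).
  rewrite -expr2 sqr_dF_orthonormal // mulmxBr raddfB /= TT.
  by rewrite [X in _ = X - _](mxtrace_mulC A) A1 mxtrace1 /T /W.
have KF' : 0 <= - \tr (S *m (T - W)).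
  rewrite mulmxBr raddfB /= opprB subr_ge0 /T /W !mulmxA.
  by rewrite (mxtrace_mulC _ A^T) (mxtrace_mulC _ V^T) !mulmxA; exact: KF.
have E2 : \tr (T *m (T - W)) - \tr (S *m (T - W)) =
    \tr ((T - Pi) *m (T - W)) + \tr ((Pi - S) *m (T - W)).
  by rewrite !mulmxBl !raddfB /=; ring.
have E3 : \tr ((T - Pi) *m (T - W)) =
    \tr (A^T *m (1%:M - W) *m (T - Pi) *m A) +
    \tr (V^T *m (1%:M - T) *m (Pi - T) *m V).
  have NT : (1%:M - T)^T = 1%:M - T by rewrite [LHS]raddfB /= trmx1 TtT.
  have DT : (T - Pi)^T = T - Pi by rewrite [LHS]raddfB /= TtT PiT.
  (* Transposition reverses the product; this is where the symmetry of [Pi] enters. *)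
  have tr1 : \tr ((T - Pi) *m ((1%:M - T) *m W)) =
      \tr (W *m (1%:M - T) *m (T - Pi)).
    by rewrite -mxtrace_tr trmx_mul (trmx_mul _ W) WtT NT DT.
  have -> : T - W = T *m (1%:M - W) - (1%:M - T) *m W.
    by rewrite mulmxBr mulmxBl mulmx1 mul1mx opprB addrA subrK.
  have tr2 : \tr ((T - Pi) *m (T *m (1%:M - W))) =
      \tr (T *m (1%:M - W) *m (T - Pi)) by rewrite mxtrace_mulC.
  rewrite mulmxBr raddfB /= tr1 tr2 (mxtrace_mulC _ A) (mxtrace_mulC _ V) !mulmxA.
  by rewrite -/T -/W -(opprB T Pi) mulmxN [X in _ = _ + X]raddfN.
rewrite /K -/T -/x dF_sym -/x opN in D1 D2 *.
move: F1 KF' E2 E3 D1 D2; rewrite E1 -/W -/T => F1 KF' E2 E3 D1 D2.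
lra.
Qed.

(** * Bounded measurable functions and independence *)

Definition bmeas {d} {T : measurableType d} {R : realType} (f : T -> R) :=
  measurable_fun setT f /\ exists c, forall x, `|f x| <= c.

Section bounded_measurable.
Context d (T : measurableType d) (R : realType).
Implicit Types f g : T -> R.

Lemma bmeas_cst (c : R) : bmeas (fun _ : T => c).
Proof. by split; [exact: measurable_cst|exists `|c|]. Qed.

Lemma bmeasD f g : bmeas f -> bmeas g -> bmeas (fun x => f x + g x).
Proof.
move=> [mf [c fc]] [mg [e ge]]; split; first exact: measurable_funD.
by exists (c + e) => x; rewrite (le_trans (ler_normD _ _)) // lerD.
Qed.

Lemma bmeasM f g : bmeas f -> bmeas g -> bmeas (fun x => f x * g x).
Proof.
move=> [mf [c fc]] [mg [e ge]]; split; first exact: measurable_funM.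
by exists (c * e) => x; rewrite normrM ler_pM.
Qed.

Lemma bmeas_sum (I : Type) (s : seq I) (h : I -> T -> R) :
  (forall i, bmeas (h i)) -> bmeas (fun x => \sum_(i <- s) h i x).
Proof.
move=> mh; elim: s => [|i s IH].
  by under eq_fun do rewrite big_nil; exact: bmeas_cst.
by under eq_fun do rewrite big_cons; exact: bmeasD.
Qed.

Variable P : probability T R.

Lemma bmeas_integrable f : bmeas f -> P.-integrable setT (EFin \o f).
Proof.
move=> [mf [c fc]]; apply: measurable_bounded_integrable => //.
  by rewrite (le_lt_trans (probability_le1 P _)) ?ltry.
exists c; split => [|M cM x _]; first exact: num_real.
by apply: le_trans (fc x) _; exact: ltW.
Qed.

Lemma Rintegral_bmeas_sum (I : Type) (s : seq I) (h : I -> T -> R) :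
  (forall i, bmeas (h i)) ->
  \int[P]_x (\sum_(i <- s) h i x) = \sum_(i <- s) \int[P]_x h i x.
Proof.
move=> mh; elim: s => [|i s IH].
  under eq_Rintegral do rewrite big_nil.
  by rewrite Rintegral_cst // mul0r big_nil.
under eq_Rintegral do rewrite big_cons.
rewrite RintegralD // ?IH ?big_cons //; first exact: bmeas_integrable.
by apply: bmeas_integrable; exact: bmeas_sum.
Qed.

Lemma Rintegral_prob_cst (c : R) : \int[P]_x c = c.
Proof.
rewrite Rintegral_cst // -[RHS]mulr1; congr (_ * _).
by rewrite -[RHS]/(fine 1%E); congr fine; exact: probability_setT.
Qed.

End bounded_measurable.

(** The variance of an average of pairwise uncorrelated variables: only diagonal terms survive, and
    each variance is at most the second moment. *)
Lemma Rintegral_sqr_mean (dO : measure_display) (Omega : measurableType dO)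
    (R : realType) (P : probability Omega R) (L : nat)
    (Z : 'I_L -> Omega -> R) (mu : R) : (0 < L)%N ->
  (forall l, bmeas (Z l)) -> (forall l, \int[P]_w Z l w = mu) ->
  (forall l l', l != l' -> \int[P]_w (Z l w * Z l' w) = mu ^+ 2) ->
  \int[P]_w ((L%:R^-1 * \sum_l Z l w - mu) ^+ 2) <=
    L%:R^-1 ^+ 2 * \sum_l \int[P]_w (Z l w ^+ 2).
Proof.
move=> L0 mZ EZ EZZ.
have LN : (L%:R : R) != 0 by rewrite pnatr_eq0 -lt0n.
(* Centring the products instead of the factors makes the off-diagonal terms integrate to 0
   directly; the remaining linear correction [lin] has mean 0. *)
pose h l l' w := Z l w * Z l' w + - mu ^+ 2.
have mZM l l' : bmeas (fun w => Z l w * Z l' w) by exact: bmeasM.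
pose lin w := \sum_l (Z l w + - mu).
have E w : (L%:R^-1 * \sum_l Z l w - mu) ^+ 2 =
    L%:R^-1 ^+ 2 * (\sum_l \sum_l' h l l' w) - (2 * mu * L%:R^-1) * lin w.
  have -> : \sum_l \sum_l' h l l' w = (\sum_l Z l w) ^+ 2 - L%:R ^+ 2 * mu ^+ 2.
    rewrite expr2 mulr_suml; transitivity
      (\sum_l (Z l w * \sum_l' Z l' w + - (L%:R * mu ^+ 2))).
      apply: eq_bigr => l _; rewrite mulr_sumr big_split /= sumr_const card_ord.
      by rewrite mulNrn mulr_natl.
    by rewrite big_split /= sumr_const card_ord -mulr_natl; ring.
  rewrite /lin big_split /= sumr_const card_ord -mulr_natl; field.
  by [].
have mh l l' : bmeas (h l l') by apply: bmeasD => //; exact: bmeas_cst.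
have mhs l : bmeas (fun w => \sum_l' h l l' w) by exact: bmeas_sum.
have mhss : bmeas (fun w => \sum_l \sum_l' h l l' w) by exact: bmeas_sum.
have ml l : bmeas (fun w => Z l w + - mu) by apply: bmeasD => //; exact: bmeas_cst.
have mlin : bmeas lin by exact: bmeas_sum.
under eq_Rintegral do rewrite E.
rewrite RintegralB //; last 2 first.
- by apply: bmeas_integrable; apply: bmeasM => //; exact: bmeas_cst.
- by apply: bmeas_integrable; apply: bmeasM => //; exact: bmeas_cst.
rewrite !RintegralZl //; try exact: bmeas_integrable.
rewrite /lin !Rintegral_bmeas_sum // [X in _ - _ * X]big1 ?mulr0 ?subr0; last first.
  move=> l _; rewrite RintegralD // ?EZ ?Rintegral_prob_cst ?subrr //.
    exact: bmeas_integrable.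
  by apply: bmeas_integrable; exact: bmeas_cst.
rewrite ler_wpM2l ?sqr_ge0 //; apply: ler_sum => l _.
rewrite Rintegral_bmeas_sum // (bigD1 l) //= big1 ?addr0 => [|l' ll'].
- rewrite /h RintegralD //; [|exact: bmeas_integrable|].
    by rewrite Rintegral_prob_cst gerDl oppr_le0 sqr_ge0.
  by apply: bmeas_integrable; exact: bmeas_cst.
- rewrite /h RintegralD //; [|exact: bmeas_integrable|].
    by rewrite EZZ 1?eq_sym // Rintegral_prob_cst subrr.
  by apply: bmeas_integrable; exact: bmeas_cst.
Qed.

Lemma Rintegral_distribution (dO dE : measure_display) (Omega : measurableType dO)
    (E : measurableType dE) (R : realType) (P : probability Omega R)
    (X : {mfun Omega >-> E}) (f : E -> R) : bmeas f ->
  \int[P]_w f (X w) = \int[distribution P X]_x f x.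
Proof.
move=> [mf [c fc]]; congr fine; symmetry; rewrite integral_pushforward //=.
  exact/measurable_EFinP.
apply: bmeas_integrable; split; last by exists c => x; exact: fc.
exact: measurableT_comp.
Qed.

Lemma eq_law_Rintegral (dO dE : measure_display) (Omega : measurableType dO)
    (E : measurableType dE) (R : realType) (P : probability Omega R)
    (X Y : {mfun Omega >-> E}) (f : E -> R) : bmeas f ->
  (forall A, measurable A -> P (X @^-1` A) = P (Y @^-1` A)) ->
  \int[P]_w f (X w) = \int[P]_w f (Y w).
Proof.
move=> bf XY; rewrite !Rintegral_distribution //.
by congr fine; apply: eq_measure_integral => A mA _; exact: XY.
Qed.

(** The joint law agrees with the product of the marginal laws on rectangles, hence everywhere, and
    Fubini factors the integral. *)
Lemma Rintegral_mulr_indep (dO dE dF : measure_display) (Omega : measurableType dO)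
    (E : measurableType dE) (F : measurableType dF) (R : realType)
    (P : probability Omega R)
    (X : {mfun Omega >-> E}) (Y : {mfun Omega >-> F}) (f : E -> R) (g : F -> R) :
  (forall A B, measurable A -> measurable B ->
     P (X @^-1` A `&` Y @^-1` B) = (P (X @^-1` A) * P (Y @^-1` B))%E) ->
  bmeas f -> bmeas g ->
  \int[P]_w (f (X w) * g (Y w)) = \int[P]_w f (X w) * \int[P]_w g (Y w).
Proof.
move=> XY bf bg.
have mXY : measurable_fun setT (fun w => (X w, Y w)).
  by apply: measurable_fun_pair.
pose XYm : {mfun Omega >-> (E * F)%type} := mfun_Sub (mem_set mXY).
pose muX := distribution P X; pose muY := distribution P Y.
have bfg : bmeas (fun z : E * F => f z.1 * g z.2).
  case: bf => mf [c fc]; case: bg => mg [e ge]; apply: bmeasM.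
  - by split; [exact: measurableT_comp|exists c => x; exact: fc].
  - by split; [exact: measurableT_comp|exists e => x; exact: ge].
rewrite (Rintegral_distribution _ _ _ _ _ _ XYm (fun z => f z.1 * g z.2) bfg).
rewrite (Rintegral_distribution _ _ _ _ _ _ X f bf).
rewrite (Rintegral_distribution _ _ _ _ _ _ Y g bg).
have -> : \int[distribution P XYm]_x (f x.1 * g x.2) =
    fine (\int[muX \x muY]_x (f x.1 * g x.2)%:E)%E.
  congr fine; apply: eq_measure_integral => A mA _.
  by symmetry; apply: product_measure_unique => // B C mB mC; rewrite -XY.
rewrite -integral12_prod_meas1; last first.
  exact: (bmeas_integrable _ _ _ (muX \x muY)%E _ bfg).
have ig : muY.-integrable setT (EFin \o g) by exact: bmeas_integrable.
have if_ : muX.-integrable setT (EFin \o f) by exact: bmeas_integrable.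
have -> : (\int[muX]_x fubini_F muY (fun z => (f z.1 * g z.2)%:E) x =
    \int[muX]_x (f x * \int[muY]_y g y)%:E)%E.
  apply: eq_integral => x _; rewrite /fubini_F /=.
  under eq_integral do rewrite EFinM.
  rewrite integralZl // EFinM /Rintegral fineK //.
  exact: integrable_fin_num.
by rewrite -[LHS]/(\int[muX]_x (f x * \int[muY]_y g y)) RintegralZr.
Qed.

Lemma measure_eq_generator d (T : measurableType d) (R : realType)
    (G : set (set T)) (m1 m2 : {measure set T -> \bar R}) :
  measurable = <<s G >> -> setI_closed G -> G setT -> (m1 setT < +oo)%E ->
  (forall A, G A -> m1 A = m2 A) -> forall A, measurable A -> m1 A = m2 A.
Proof.
move=> mG IG GT m1T m12 A; apply: (measure_unique G (fun=> setT)) => //.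
by rewrite bigcup_const.
Qed.

Lemma indep_generator (dO dE dF : measure_display) (Omega : measurableType dO)
    (E : measurableType dE) (F : measurableType dF) (R : realType)
    (P : probability Omega R)
    (X : {mfun Omega >-> E}) (Y : {mfun Omega >-> F})
    (G : set (set E)) (H : set (set F)) :
  measurable = <<s G >> -> setI_closed G -> G setT ->
  measurable = <<s H >> -> setI_closed H -> H setT ->
  (forall A B, G A -> H B ->
     P (X @^-1` A `&` Y @^-1` B) = (P (X @^-1` A) * P (Y @^-1` B))%E) ->
  forall A B, measurable A -> measurable B ->
     P (X @^-1` A `&` Y @^-1` B) = (P (X @^-1` A) * P (Y @^-1` B))%E.
Proof.
move=> mG IG GT mH IH HT GH.
(* For a fixed event [C], both sides are finite measures in [A] that agree on a pi-system. Applied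
   once in each variable, this extends the factorisation from generators to all measurable sets. *)
have step (dS dU : measure_display) (S : measurableType dS) (V : measurableType dU)
    (Z : {mfun Omega >-> S}) (K : set (set S)) (C : set Omega) :
    measurable = <<s K >> -> setI_closed K -> K setT -> measurable C ->
    (forall A, K A -> P (Z @^-1` A `&` C) = (P (Z @^-1` A) * P C)%E) ->
    forall A, measurable A -> P (Z @^-1` A `&` C) = (P (Z @^-1` A) * P C)%E.
  move=> mK IK KT mC hK A mA.
  pose m1 := pushforward (mrestr P mC) Z.
  have PC : (0 <= fine (P C)) by rewrite fine_ge0.
  pose m2 := mscale (NngNum PC) (distribution P Z).
  have m2E B : m2 B = (P (Z @^-1` B) * P C)%E.
    by rewrite /m2 /mscale /= fineK ?fin_num_measure // muleC.
  rewrite -m2E; apply: (measure_eq_generator _ _ _ K m1 m2) => //.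
    apply: (@le_lt_trans _ _ 1%E); last exact: ltry.
    apply: probability_le1; apply: measurableI => //.
    by rewrite -[_ @^-1` _]setTI; exact: measurable_funPT.
  by move=> B KB; rewrite [RHS]m2E -hK.
move=> A B mA mB; apply: (step _ _ _ E X G) => //.
  by rewrite -[_ @^-1` _]setTI; exact: measurable_funPT.
move=> {A mA} A GA; rewrite setIC muleC; move: B mB.
apply: (step _ _ _ F Y H) => //.
  rewrite -[_ @^-1` _]setTI; apply: measurable_funPT => //.
  by rewrite mG; exact: sub_sigma_algebra.
by move=> B HB; rewrite setIC muleC GH.
Qed.

(** * Averages of uncorrelated matrices in Frobenius norm *)

Lemma frobnorm_gram_le (R : realType) p d (A : 'M[R]_(p, d)) :
  unit_cols R p d A -> frobnorm R p p (A *m A^T) <= d%:R.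
Proof.
move=> uA; apply: le_trans (frobnorm_mulmx _ _ _ _ _ _) _.
rewrite frobnorm_tr -expr2 sqr_frobnorm /mxtrace.
by under eq_bigr do rewrite uA; rewrite sumr_const card_ord.
Qed.

(** The scalar variance bound is applied entrywise, but the second moments are summed over the
    entries before [c] is used, so no factor [p ^ 2] is lost. *)
Lemma Rintegral_frobnorm_mean (dO : measure_display) (Omega : measurableType dO)
    (R : realType) (P : probability Omega R) (L p : nat)
    (Z : 'I_L -> Omega -> 'M[R]_p) (Mu : 'M[R]_p) (c : R) : (0 < L)%N ->
  (forall l i j, bmeas (fun w => Z l w i j)) ->
  (forall l i j, \int[P]_w Z l w i j = Mu i j) ->
  (forall l l' i j, l != l' ->
     \int[P]_w (Z l w i j * Z l' w i j) = Mu i j ^+ 2) ->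
  (forall l w, frobnorm R p p (Z l w) <= c) ->
  bmeas (fun w => frobnorm R p p (L%:R^-1 *: \sum_l Z l w - Mu) ^+ 2) /\
  \int[P]_w (frobnorm R p p (L%:R^-1 *: \sum_l Z l w - Mu) ^+ 2) <= c ^+ 2 / L%:R.
Proof.
move=> L0 mZ EZ EZZ Zc.
have sqr_frob (A : 'M[R]_p) :
    frobnorm R p p A ^+ 2 = \sum_i \sum_j A i j ^+ 2.
  by rewrite sqr_frobnorm mxtrace_trmulE.
pose h i j w := (L%:R^-1 * (\sum_l Z l w i j) - Mu i j) ^+ 2.
have hE w : frobnorm R p p (L%:R^-1 *: \sum_l Z l w - Mu) ^+ 2 =
    \sum_i \sum_j h i j w.
  rewrite sqr_frob; apply: eq_bigr => i _; apply: eq_bigr => j _.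
  by rewrite !mxE summxE.
have msq f : bmeas f -> bmeas (fun w : Omega => f w ^+ 2 : R).
  by move=> mf; exact: bmeasM.
have mh i j : bmeas (h i j).
  apply: msq; apply: bmeasD; last exact: bmeas_cst.
  by apply: bmeasM; [exact: bmeas_cst|exact: bmeas_sum].
have mhs i : bmeas (fun w => \sum_j h i j w) by exact: bmeas_sum.
split; first by under eq_fun do rewrite hE; exact: bmeas_sum.
under eq_Rintegral do rewrite hE.
rewrite Rintegral_bmeas_sum //.
under eq_bigr do rewrite Rintegral_bmeas_sum //.
have hle i j : \int[P]_w h i j w <=
    L%:R^-1 ^+ 2 * \sum_l \int[P]_w (Z l w i j ^+ 2).
  by apply: (Rintegral_sqr_mean _ _ _ _ _ (fun l w => Z l w i j)) => // l l'; exact: EZZ.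
apply: le_trans (_ : \sum_i \sum_j
    L%:R^-1 ^+ 2 * \sum_l \int[P]_w (Z l w i j ^+ 2) <= _).
  by apply: ler_sum => i _; apply: ler_sum => j _; exact: hle.
under eq_bigr do rewrite -mulr_sumr exchange_big.
rewrite -mulr_sumr exchange_big /=.
apply: le_trans (_ : L%:R^-1 ^+ 2 * \sum_(l < L) c ^+ 2 <= _); last first.
  rewrite sumr_const card_ord -(mulr_natr (c ^+ 2)) mulrCA (expr2 L%:R^-1) -(mulrA L%:R^-1).
  by rewrite mulVf ?mulr1 // pnatr_eq0 -lt0n.
rewrite ler_wpM2l ?sqr_ge0 //; apply: ler_sum => l _.
have mZ2 i j : bmeas (fun w => Z l w i j ^+ 2) by exact: msq.
have mZ2s i : bmeas (fun w => \sum_j Z l w i j ^+ 2) by exact: bmeas_sum.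
under eq_bigr do rewrite -Rintegral_bmeas_sum //.
rewrite -Rintegral_bmeas_sum // -[leRHS](Rintegral_prob_cst _ _ _ P).
apply: le_Rintegral => //.
- by apply: bmeas_integrable; exact: bmeas_sum.
- by apply: bmeas_integrable; exact: bmeas_cst.
move=> w _; rewrite -sqr_frob ler_pXn2r ?nnegrE ?frobnorm_ge0 //.
by apply: le_trans (Zc l w); exact: frobnorm_ge0.
Qed.

(** * Measurability of the residuals and form of the selection rule *)

Lemma measurable_forall d (T : measurableType d) (I : finType) (f : I -> T -> bool) :
  (forall i, measurable_fun setT (f i)) ->
  measurable_fun setT (fun x => [forall i, f i x]).
Proof.
move=> mf.
have E x : [forall i, f i x] = \big[andb/true]_i f i x by rewrite big_andE.
under eq_fun do rewrite E; elim: index_enum => [|i s IH].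
  by under eq_fun do rewrite big_nil; exact: measurable_cst.
by under eq_fun do rewrite big_cons; exact: measurable_and.
Qed.

Lemma measurable_mx_entry (R : realType) m n (i : 'I_m) (j : 'I_n) :
  measurable_fun setT (fun A : mxM R m n => A i j).
Proof.
move=> _ B mB; rewrite setTI; apply: sub_sigma_algebra.
by exists i, j, B.
Qed.

Lemma measurable_fun_mx d (T : measurableType d) (R : realType) m n
    (f : T -> mxM R m n) :
  (forall i j, measurable_fun setT (fun x => f x i j)) -> measurable_fun setT f.
Proof.
move=> mf; apply: (@measurability _ _ T (mxM R m n) setT f (mx_gen R m n)) => //.
move=> _ [_ [i [j [B [mB ->]]]] <-].
exact: (mf i j measurableT B mB).
Qed.

Lemma measurable_mulmx_entry d (T : measurableType d) (R : realType) m n k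
    (f : T -> 'M[R]_(m, n)) (h : T -> 'M[R]_(n, k)) i j :
  (forall a b, measurable_fun setT (fun x => f x a b)) ->
  (forall a b, measurable_fun setT (fun x => h x a b)) ->
  measurable_fun setT (fun x => (f x *m h x) i j).
Proof.
move=> mf mh; under eq_fun do rewrite mxE.
by apply: measurable_sum => l; exact: measurable_funM.
Qed.

Lemma unit_colsP (R : realType) p d (A : 'M[R]_(p, d)) :
  reflect (unit_cols R p d A) [forall j, (A^T *m A) j j == 1].
Proof. by apply: (iffP forallP) => H j; apply/eqP; exact: H. Qed.

Lemma measurable_fun_unit_cols (R : realType) p d :
  measurable_fun setT (fun A : mxM R p d => [forall j, (A^T *m A) j j == 1]).
Proof.
apply: measurable_forall => j; apply: measurable_fun_eqr; last exact: measurable_cst.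
apply: measurable_mulmx_entry => a b; last exact: measurable_mx_entry.
by under eq_fun do rewrite mxE; exact: measurable_mx_entry.
Qed.

Lemma measurable_unit_cols (R : realType) p d :
  measurable [set A : mxM R p d | unit_cols R p d A].
Proof.
have := measurable_fun_unit_cols R p d measurableT [set true].
rewrite setTI => /(_ _); have -> : (fun A : mxM R p d =>
    [forall j, (A^T *m A) j j == 1]) @^-1` [set true] =
    [set A | unit_cols R p d A].
  by apply/seteqP; split => A /= /unit_colsP.
by apply.
Qed.

Lemma measurable_resid (R : realType) p d n n1
    (g : 'cV[R]_d -> 'M[R]_(n1, d + 1) -> R)
    (X : 'I_n -> 'cV[R]_p) (y : 'I_n -> R) (N : {set 'I_n}) :
  measurable_fun setT
    (fun z : (mxM R d 1 * mxM R n1 (d + 1))%type => g z.1 z.2) ->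
  measurable_fun setT (fun A : mxM R p d => resid R p d n n1 g X y A N).
Proof.
move=> mg; have mproj (x : 'cV[R]_p) a b :
    measurable_fun setT (fun A : mxM R p d => (A^T *m x) a b).
  apply: measurable_mulmx_entry => u v; last exact: measurable_cst.
  by under eq_fun do rewrite mxE; exact: measurable_mx_entry.
under eq_fun do rewrite /resid big_mkcond.
apply: measurable_sum => i; case: (i \notin N); last exact: measurable_cst.
apply: (@measurable_funX _ _ R); apply: measurable_funB; first exact: measurable_cst.
pose h1 (A : mxM R p d) : mxM R d 1 := A^T *m X i.
pose h2 (A : mxM R p d) : mxM R n1 (d + 1) := train R p d n n1 X y A N.
suff mh : measurable_fun setT (fun A => (h1 A, h2 A)).
  exact: (measurableT_comp mg mh).
apply: measurable_fun_pair.
  by apply: measurable_fun_mx => a b; exact: mproj.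
apply: measurable_fun_mx => a b; rewrite /h2 /train.
case: (enum N) => [|i0 s]; first exact: measurable_cst.
under eq_fun do rewrite mxE.
case: (fintype.split b) => c; under eq_fun do rewrite mxE.
  exact: mproj.
exact: measurable_cst.
Qed.

(** At most one index passes the test, so the selection becomes a finite sum of indicator terms,
    from which measurability can be read off. [F 0 = 0] matches the default value 0 of
    [select_proj]. *)
Lemma select_projE (R : realType) p d M (Ps : 'I_M -> 'M[R]_(p, d))
    (Rh : 'I_M -> R) (F : 'M[R]_(p, d) -> R) : F 0 = 0 ->
  F (select_proj R p d M Ps Rh) =
  \sum_m (if [forall m' : 'I_M, Rh m <= Rh m'] &&
             [forall m' : 'I_M, (m' < m)%N ==> (Rh m < Rh m')]
          then F (Ps m) else 0).
Proof.
move=> F0; rewrite /select_proj; case: pickP => [m|none]; last first.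
  by rewrite F0 big1 // => m _; rewrite none.
move=> selm; have /andP[/forallP minm /forallP firstm] := selm.
rewrite (bigD1 m) //= selm big1 ?addr0 // => m' m'm.
case: ifP => // /andP[/forallP minm' /forallP firstm'].
case: (ltngtP m m') => [mm'|m'm0|/val_inj mm']; last by rewrite mm' eqxx in m'm.
- by have := implyP (firstm' m) mm'; rewrite ltNge minm.
- by have := implyP (firstm m') m'm0; rewrite ltNge minm'.
Qed.

Lemma frobnorm_select_proj_le (R : realType) p d M (Ps : 'I_M -> 'M[R]_(p, d))
    (Rh : 'I_M -> R) : (forall m, unit_cols R p d (Ps m)) ->
  frobnorm R p p (select_proj R p d M Ps Rh *m (select_proj R p d M Ps Rh)^T) <= d%:R.
Proof.
move=> uPs; rewrite /select_proj; case: pickP => [m _|_].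
  exact: frobnorm_gram_le.
rewrite mul0mx /frobnorm big1 ?sqrtr0 // => i _.
by rewrite big1 // => j _; rewrite mxE expr0n.
Qed.

(** * The groups of draws *)

(* The values of one group of draws (P_{l,1}, ..., P_{l,M}, N_1), with the
   sigma-algebra generated by the measurable rectangles. *)
Definition drawT (R : realType) p d M n :=
  (('I_M -> mxM R p d) * {set 'I_n})%type.
HB.instance Definition _ (R : realType) p d M n := gen_eqMixin (drawT R p d M n).
HB.instance Definition _ (R : realType) p d M n := gen_choiceMixin (drawT R p d M n).
HB.instance Definition _ (R : realType) p d M n :=
  isPointed.Build (drawT R p d M n) (fun=> 0, finset.set0).

Definition draw_rect (R : realType) p d M n
    (B : 'I_M -> set (mxM R p d)) (C : set {set 'I_n}) : set (drawT R p d M n) :=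
  [set x | (forall m, B m (x.1 m)) /\ C x.2].
Definition draw_gen (R : realType) p d M n : set (set (drawT R p d M n)) :=
  [set S | exists B C, (forall m, measurable (B m)) /\ S = draw_rect R p d M n B C].
Definition drawM (R : realType) p d M n :=
  g_sigma_algebraType (draw_gen R p d M n).

Section draws.
Context (R : realType) (p d M n : nat).
Local Notation E := (drawM R p d M n).
Local Notation rect := (draw_rect R p d M n).

Lemma draw_gen_setT : draw_gen R p d M n setT.
Proof.
exists (fun=> setT), setT; split => //.
by apply/seteqP; split.
Qed.

Lemma draw_gen_setI_closed : setI_closed (draw_gen R p d M n).
Proof.
move=> _ _ [B [C [mB ->]]] [B' [C' [mB' ->]]].
exists (fun m => B m `&` B' m), (C `&` C'); split.
  by move=> m; exact: measurableI.
apply/seteqP; split => x /=.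
  by move=> [[Bx Cx] [B'x C'x]]; split.
by move=> [BB' [Cx C'x]]; split; split => // m; case: (BB' m).
Qed.

Lemma measurable_draw_rect B C : (forall m, measurable (B m)) ->
  measurable (rect B C : set E).
Proof. by move=> mB; apply: sub_sigma_algebra; exists B, C. Qed.

Lemma measurable_draw_proj m : measurable_fun setT (fun x : E => x.1 m).
Proof.
move=> _ A mA; rewrite setTI.
have -> : (fun x : E => x.1 m) @^-1` A =
    rect (fun k => if k == m then A else setT) setT.
  apply/seteqP; split => x /=.
    by move=> Ax; split => // k; case: eqP => [->|].
  by move=> [/(_ m)]; rewrite eqxx.
by apply: measurable_draw_rect => k; case: eqP.
Qed.

Lemma measurable_draw_subset (N : {set 'I_n}) :
  measurable_fun setT (fun x : E => x.2 == N).
Proof.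
apply: (measurable_fun_bool true); rewrite setTI.
have -> : (fun x : E => x.2 == N) @^-1` [set true] = rect (fun=> setT) [set N].
  apply/seteqP; split => x /=; first by move=> /eqP xN; split.
  by move=> [_ ->]; rewrite eqxx.
exact: measurable_draw_rect.
Qed.

Lemma measurable_fun_draw d' (T : measurableType d') (f : T -> E) :
  (forall m, measurable_fun setT (fun w => (f w).1 m)) ->
  (forall N, measurable [set w | (f w).2 = N]) ->
  measurable_fun setT f.
Proof.
move=> mP mN; apply: (@measurability _ _ T E setT f (draw_gen R p d M n)) => //.
move=> _ [_ [B [C [mB ->]]] <-]; rewrite setTI.
have -> : f @^-1` rect B C =
    (\bigcap_(m in [set: 'I_M]) (fun w => (f w).1 m) @^-1` B m) `&`
    (\bigcup_(N in C) [set w | (f w).2 = N]).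
  apply/seteqP; split => w /=.
    by move=> [Bw Cw]; split; [move=> m _; exact: Bw|exists (f w).2].
  by move=> [Bw [N CN /= wN]]; split; [move=> m; exact: Bw|rewrite wN].
apply: measurableI.
  apply: fin_bigcap_measurable => // m _.
  by rewrite -[_ @^-1` _]setTI; exact: mP.
by apply: fin_bigcup_measurable => // N _; exact: mN.
Qed.

Variables (n1 : nat) (g : 'cV[R]_d -> 'M[R]_(n1, d + 1) -> R).
Variables (X : 'I_n -> 'cV[R]_p) (y : 'I_n -> R).
Hypothesis mg : measurable_fun setT
  (fun z : (mxM R d 1 * mxM R n1 (d + 1))%type => g z.1 z.2).

(** A deterministic function of one group of draws, so that equality in law and independence of the
    groups pass to the selected projections. *)
Definition draw_select (x : E) : 'M[R]_(p, d) :=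
  select_proj R p d M x.1 (fun m => resid R p d n n1 g X y (x.1 m) x.2).

Lemma measurable_draw_select i j :
  measurable_fun setT (fun x => (draw_select x *m (draw_select x)^T) i j).
Proof.
pose Rh m (x : E) := resid R p d n n1 g X y (x.1 m) x.2.
have mRh m : measurable_fun setT (Rh m).
  (* The subset takes finitely many values; on each of them the residual depends on the projection
     only. *)
  have RhE x : Rh m x = \sum_(N : {set 'I_n})
      (if x.2 == N then resid R p d n n1 g X y (x.1 m) N else 0).
    rewrite (bigD1 x.2) //= eqxx big1 ?addr0 // => N Nx.
    by rewrite eq_sym (negbTE Nx).
  rewrite (funext RhE).
  apply: measurable_sum => N; apply: measurable_fun_ifT; last exact: measurable_cst.
    exact: measurable_draw_subset.
  apply: (measurableT_comp (measurable_resid R p d n n1 g X y N mg)).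
  exact: measurable_draw_proj.
pose F (A : 'M[R]_(p, d)) := (A *m A^T) i j.
have F0 : F 0 = 0 by rewrite /F mul0mx mxE.
rewrite (_ : (fun x => _) = fun x => F (draw_select x)) //.
under eq_fun do rewrite /draw_select select_projE //.
apply: measurable_sum => m; apply: measurable_fun_ifT.
- apply: measurable_and; apply: measurable_forall => m'.
    exact: (measurable_fun_ler (mRh m) (mRh m')).
  by case: (m' < m)%N => /=;
    [exact: (measurable_fun_ltr (mRh m) (mRh m'))|exact: measurable_cst].
- apply: measurable_mulmx_entry => a b.
    apply: (measurableT_comp (measurable_mx_entry R p d a b)).
    exact: measurable_draw_proj.
  under eq_fun do rewrite mxE.
  apply: (measurableT_comp (measurable_mx_entry R p d b a)).
  exact: measurable_draw_proj.
- exact: measurable_cst.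
Qed.

Definition draw_good (x : E) : bool :=
  [forall m, [forall j, ((x.1 m)^T *m x.1 m) j j == 1]].

Lemma draw_goodP (x : E) : reflect (forall m, unit_cols R p d (x.1 m)) (draw_good x).
Proof.
by apply: (iffP forallP) => H m; exact/unit_colsP.
Qed.

Lemma measurable_draw_good : measurable_fun setT draw_good.
Proof.
apply: measurable_forall => m.
exact: (measurableT_comp (measurable_fun_unit_cols R p d) (measurable_draw_proj m)).
Qed.

(* P_{l,*} P_{l,*}^T, set to 0 on the null event that some projection does not
   have unit columns, which makes it bounded everywhere. *)
Definition draw_gram (x : E) : 'M[R]_p :=
  if draw_good x then draw_select x *m (draw_select x)^T else 0.

Lemma frobnorm_draw_gram x : frobnorm R p p (draw_gram x) <= d%:R.
Proof.
rewrite /draw_gram; case: draw_goodP => [good|_].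
  exact: frobnorm_select_proj_le.
rewrite /frobnorm big1 ?sqrtr0 // => i _.
by rewrite big1 // => j _; rewrite mxE expr0n.
Qed.

Lemma bmeas_draw_gram i j : bmeas (fun x => draw_gram x i j).
Proof.
split.
  have E1 x : draw_gram x i j =
      if draw_good x then (draw_select x *m (draw_select x)^T) i j else 0.
    by rewrite /draw_gram; case: ifP => // _; rewrite mxE.
  under eq_fun do rewrite E1.
  apply: measurable_fun_ifT; last exact: measurable_cst.
    exact: measurable_draw_good.
  exact: measurable_draw_select.
exists d%:R => x; apply: le_trans (frobnorm_draw_gram x).
rewrite -sqrtr_sqr ler_sqrt; last first.
  by apply: sumr_ge0 => k _; apply: sumr_ge0 => l _; exact: sqr_ge0.
rewrite (bigD1 i) //= (bigD1 j) //= -addrA lerDl addr_ge0 //.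
  by apply: sumr_ge0 => k _; exact: sqr_ge0.
by apply: sumr_ge0 => k _; apply: sumr_ge0 => l _; exact: sqr_ge0.
Qed.

End draws.

(* Holds without measurability, the integral of a nonnegative function being a
   supremum over the simple functions below it. It is needed because nothing
   makes the choice of the singular vectors [U] measurable. *)
Lemma ge0_le_expectation_nonmeasurable (d : measure_display)
    (T : measurableType d) (R : realType) (P : probability T R) (f g : T -> R) :
  (forall x, 0 <= f x) -> (forall x, f x <= g x) -> ('E_P[f] <= 'E_P[g])%E.
Proof.
move=> f0 fg; rewrite unlock !ge0_integralE => [|x _|x _]; last 2 first.
- by rewrite lee_fin (le_trans (f0 x)).
- by rewrite lee_fin.
apply: ge_ereal_sup => _ [h hf <-]; apply: ereal_sup_ubound.
exists h => // x; apply: le_trans (hf x) _.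
by rewrite !patchT ?inE // lee_fin.
Qed.

(** Only the masses of the subsets of size [k] are prescribed, but the ['C(n, k)] of them already
    sum to 1, so every other subset is null and the law is determined. *)
Lemma uniform_subset_law (dO : measure_display) (Omega : measurableType dO)
    (R : realType) (P : probability Omega R) (n k : nat) (N N' : Omega -> {set 'I_n}) :
  (k <= n)%N ->
  (forall S, measurable (N @^-1` [set S])) ->
  (forall S, measurable (N' @^-1` [set S])) ->
  (forall S : {set 'I_n}, #|S| = k -> P (N @^-1` [set S]) = ('C(n, k)%:R^-1)%:E) ->
  (forall S : {set 'I_n}, #|S| = k -> P (N' @^-1` [set S]) = ('C(n, k)%:R^-1)%:E) ->
  forall C : set {set 'I_n}, P (N @^-1` C) = P (N' @^-1` C).
Proof.
move=> kn mN mN' lN lN' C.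
have preE (V : Omega -> {set 'I_n}) (D : set {set 'I_n}) :
    V @^-1` D = \bigcup_(S in D) (V @^-1` [set S]).
  by apply/seteqP; split => w /=; [move=> DV; exists (V w)|move=> [S DS /= ->]].
have law (V : Omega -> {set 'I_n}) (D : set {set 'I_n}) :
    (forall S, measurable (V @^-1` [set S])) ->
    P (V @^-1` D) = (\sum_(S \in D) P (V @^-1` [set S]))%E.
  move=> mV; rewrite preE measure_fin_bigcup //; first exact: finite_finset.
  by move=> S S' _ _ [w [/= -> ->]].
have null (V : Omega -> {set 'I_n}) :
    (forall S, measurable (V @^-1` [set S])) ->
    (forall S : {set 'I_n}, #|S| = k -> P (V @^-1` [set S]) = ('C(n, k)%:R^-1)%:E) ->
    forall S : {set 'I_n}, #|S| <> k -> P (V @^-1` [set S]) = 0%E.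
  move=> mV lV S Sk.
  pose A := finset (fun S : {set 'I_n} => #|S| == k).
  have mA : measurable (V @^-1` [set` A]).
    by rewrite preE; apply: fin_bigcup_measurable.
  have PA : P (V @^-1` [set` A]) = 1%E.
    have -> : P (V @^-1` [set` A]) = (\sum_(S' in A) P (V @^-1` [set S']))%E.
      rewrite law // -(bigfs _ (r := index_enum _)) ?index_enum_uniq //.
      by move=> S' _; rewrite mem_index_enum.
    rewrite (eq_bigr (fun=> ('C(n, k)%:R^-1)%:E)); last first.
      by move=> S'; rewrite inE => /eqP; exact: lV.
    rewrite sumEFin sumr_const card_draws card_ord -(mulr_natr _^-1) mulVf //.
    by rewrite pnatr_eq0 -lt0n bin_gt0.
  apply/eqP; rewrite eq_le measure_ge0 andbT.
  have <- : P (~` (V @^-1` [set` A])) = 0%E by rewrite probability_setC // PA subee.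
  apply: le_measure; rewrite ?inE //; first exact: measurableC.
  by move=> w /= -> ; rewrite inE => /eqP.
rewrite !law //; apply: eq_fsbigr => S _.
by have [Sk|/eqP Sk] := eqVneq #|S| k; [rewrite lN ?lN'|rewrite !null].
Qed.

(** * Law and independence of the groups of draws *)

Section projection_draws.
Context (R : realType) (p d L M n : nat).
Context (dO : measure_display) (Omega : measurableType dO) (P : probability Omega R).
Variables (Proj : 'I_L -> 'I_M -> Omega -> mxM R p d).
Variables (Nsub : 'I_L -> Omega -> {set 'I_n}).
Hypothesis mProj : forall l m, measurable_fun setT (Proj l m).
Hypothesis mNsub : forall l (S : {set 'I_n}), measurable (Nsub l @^-1` [set S]).
Hypothesis indep : mutual_indep dO Omega R P ('I_L * 'I_M + 'I_L)%type
  (fun i => match i with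
     | inl lm => [set Proj lm.1 lm.2 @^-1` B | B in
                    (measurable : set (set (mxM R p d)))]
     | inr l => [set Nsub l @^-1` B | B in [set: set {set 'I_n}]]
     end).

Definition draw (l : 'I_L) (w : Omega) : drawM R p d M n :=
  (fun m => Proj l m w, Nsub l w).

Lemma measurable_draw l : measurable_fun setT (draw l).
Proof. by apply: measurable_fun_draw => [m|S]; [exact: mProj|exact: mNsub]. Qed.

Definition draw_mfun l : {mfun Omega >-> drawM R p d M n} :=
  mfun_Sub (mem_set (measurable_draw l)).

(** Mutual independence applied to all single draws in the groups of [J]. A singleton [J] gives the
    law of one group, a pair gives the independence of two. *)
Lemma probability_draw_rects (J : {set 'I_L})
    (B : 'I_L -> 'I_M -> set (mxM R p d)) (C : 'I_L -> set {set 'I_n}) :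
  (forall l m, measurable (B l m)) ->
  P (\bigcap_(l in [set` J]) draw l @^-1` draw_rect R p d M n (B l) (C l)) =
  (\prod_(l in J) ((\prod_m P (Proj l m @^-1` B l m)) * P (Nsub l @^-1` C l)))%E.
Proof.
move=> mB.
pose JJ : {set ('I_L * 'I_M + 'I_L)} :=
  finset (fun i => match i with inl lm => lm.1 \in J | inr l => l \in J end).
pose E (i : 'I_L * 'I_M + 'I_L) : set Omega :=
  match i with
  | inl lm => Proj lm.1 lm.2 @^-1` B lm.1 lm.2
  | inr l => Nsub l @^-1` C l
  end.
have -> : \bigcap_(l in [set` J]) draw l @^-1` draw_rect R p d M n (B l) (C l) =
    \bigcap_(i in [set i | i \in JJ]) E i.
  apply/seteqP; split => w /=.
    by move=> H [[l m]|l] /=; rewrite inE /= => lJ; case: (H l lJ).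
  move=> H l lJ; split => [m|].
    by have /(_ _)/= := H (inl (l, m)); rewrite inE; apply.
  by have /(_ _)/= := H (inr l); rewrite inE; apply.
rewrite (indep JJ E); last first.
  by move=> [[l m]|l] _ /=; [exists (B l m)|exists (C l)].
rewrite big_sumType /= [RHS]big_split /=; congr (_ * _)%E.
  rewrite pair_big_dep /=; apply: eq_bigl => -[l m].
  by rewrite inE /= andbT.
by apply: eq_bigl => l; rewrite inE.
Qed.

Lemma probability_draw_rect l (B : 'I_M -> set (mxM R p d)) (C : set {set 'I_n}) :
  (forall m, measurable (B m)) ->
  P (draw l @^-1` draw_rect R p d M n B C) =
  ((\prod_m P (Proj l m @^-1` B m)) * P (Nsub l @^-1` C))%E.
Proof.
move=> mB; have := probability_draw_rects (finset.set1 l) (fun=> B) (fun=> C).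
rewrite big_set1 => <- //; congr (P _); apply/seteqP; split => w /=.
  by move=> H l' /finset.set1P ->.
by move=> /(_ l); apply; exact/finset.set1P.
Qed.

Lemma draw_indep l l' : l != l' -> forall A A', measurable A -> measurable A' ->
  P (draw_mfun l @^-1` A `&` draw_mfun l' @^-1` A') =
  (P (draw_mfun l @^-1` A) * P (draw_mfun l' @^-1` A'))%E.
Proof.
move=> ll'; apply: (@indep_generator _ _ _ Omega (drawM R p d M n) (drawM R p d M n)
    R P (draw_mfun l) (draw_mfun l') (draw_gen R p d M n) (draw_gen R p d M n)) => //;
  try exact: draw_gen_setT; try exact: draw_gen_setI_closed.
move=> _ _ [B [C [mB ->]]] [B' [C' [mB' ->]]].
rewrite [X in _ = (X * _)%E](probability_draw_rect l B C mB).
rewrite [X in _ = (_ * X)%E](probability_draw_rect l' B' C' mB').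
have l'l : (l' == l) = false by apply/negbTE; rewrite eq_sym.
have mBB k m : measurable ((if k == l then B else B') m) by case: ifP.
have := probability_draw_rects (l |: finset.set1 l')%SET
  (fun k => if k == l then B else B') (fun k => if k == l then C else C') mBB.
rewrite big_setU1 ?inE //= big_set1 eqxx l'l => <-.
congr (P _); apply/seteqP; split => w /=.
  by move=> [Bw B'w] k /finset.set2P[->|->]; rewrite ?eqxx ?l'l.
move=> H; split.
  by have := H l (finset.set21 l l'); rewrite /= eqxx.
by have := H l' (finset.set22 l l'); rewrite /= l'l.
Qed.

Lemma draw_eq_law l l' :
  (forall m (B : set (mxM R p d)), measurable B ->
     P (Proj l m @^-1` B) = P (Proj l' m @^-1` B)) ->
  (forall C, P (Nsub l @^-1` C) = P (Nsub l' @^-1` C)) ->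
  forall A, measurable A -> P (draw_mfun l @^-1` A) = P (draw_mfun l' @^-1` A).
Proof.
move=> eP eN A mA.
apply: (@measure_eq_generator _ (drawM R p d M n) R (draw_gen R p d M n)
  (distribution P (draw_mfun l)) (distribution P (draw_mfun l'))) => //.
- exact: draw_gen_setI_closed.
- exact: draw_gen_setT.
- by rewrite (le_lt_trans (probability_le1 _ _)) ?ltry.
move=> _ [B [C [mB ->]]].
rewrite [LHS](probability_draw_rect l B C mB).
rewrite [RHS](probability_draw_rect l' B C mB) eN.
by congr (_ * _)%E; apply: eq_bigr => m _; exact: eP.
Qed.

End projection_draws.

(** * The bound in expectation *)

Theorem theorem1
  (R : realType) (p d d0 L M n n1 : nat)
  (hp : (0 < p)%N) (hd : (0 < d)%N) (hd0 : (0 < d0)%N) (hL : (0 < L)%N)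
  (hM : (0 < M)%N) (hn : (0 < n)%N) (hn1 : (0 < n1)%N)
  (hdp : (d <= p)%N) (hd0p : (d0 <= p)%N) (hn1n : (n1 <= n - 1)%N)
  (* deterministic data *)
  (X : 'I_n -> 'cV[R]_p) (y : 'I_n -> R)
  (* distribution Q on Q_{p x d} *)
  (Q : probability (mxM R p d) R)
  (hQ : Q [set A : mxM R p d | unit_cols R p d A] = 1%E)
  (* base regression method in G_{d,n1}: measurable *)
  (g : 'cV[R]_d -> 'M[R]_(n1, d + 1) -> R)
  (hg : measurable_fun setT
          (fun z : (mxM R d 1 * mxM R n1 (d + 1))%type => g z.1 z.2))
  (A0 : 'M[R]_(p, d0)) (hA0 : A0^T *m A0 = 1%:M)
  (* underlying probability space carrying the projections and subsamples *)
  (dO : measure_display) (Omega : measurableType dO) (P : probability Omega R)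
  (Proj : 'I_L -> 'I_M -> Omega -> mxM R p d)
  (Nsub : 'I_L -> Omega -> {set 'I_n})
  (hProj_meas : forall l m, measurable_fun setT (Proj l m))
  (hProj_law : forall l m (B : set (mxM R p d)), measurable B ->
     P (Proj l m @^-1` B) = Q B)
  (hNsub_meas : forall l (S : {set 'I_n}), measurable (Nsub l @^-1` [set S]))
  (hNsub_law : forall l (S : {set 'I_n}), #|S| = n1 ->
     P (Nsub l @^-1` [set S]) = ((('C(n, n1))%:R)^-1)%:E)
  (hindep : mutual_indep dO Omega R P ('I_L * 'I_M + 'I_L)%type
     (fun i => match i with
       | inl lm => [set Proj lm.1 lm.2 @^-1` B | B in
                      (measurable : set (set (mxM R p d)))]
       | inr l => [set Nsub l @^-1` B | B in [set: set {set 'I_n}]]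
       end))
  (* SVD of Pi_hat: any choice of (orthonormal, decreasing) decomposition *)
  (U : Omega -> 'M[R]_p)
  (hU : forall w,
     let Pst := fun l : 'I_L => select_proj R p d M (fun m => Proj l m w)
                  (fun m => resid R p d n n1 g X y (Proj l m w) (Nsub l w)) in
     is_svd R p ((L%:R)^-1 *: \sum_(l < L) (Pst l *m (Pst l)^T)) (U w))
  (* Pi^infty = E(P_{l,*} P_{l,*}^T), computed for an arbitrary l0 *)
  (l0 : 'I_L) :
  let Pst0 := fun w => select_proj R p d M (fun m => Proj l0 m w)
                (fun m => resid R p d n n1 g X y (Proj l0 m w) (Nsub l0 w)) in
  let Piinf : 'M[R]_p :=
    \matrix_(i, j) fine ('E_P[fun w => (Pst0 w *m (Pst0 w)^T) i j]) in
  ('E_P[fun w => dF R p d0 (U w *m pid_mx d0) A0] <=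
    (2 * Num.sqrt (d0%:R) * opnorm R p p (Piinf - A0 *m A0^T)
     + 2 * Num.sqrt (d0%:R) * Num.sqrt (2 * pi) * p%:R / Num.sqrt (L%:R))%:E)%E.
Proof.
lazy zeta; set Piinf := (X in opnorm R p p (X - _)).
have mN := hNsub_meas; have mP := hProj_meas.
have n1n : (n1 <= n)%N by rewrite (leq_trans hn1n) ?leq_subr.
pose W := draw_mfun R p d L M n dO Omega Proj Nsub mP mN.
pose sel l w := draw_select R p d M n n1 g X y (W l w).
pose G l w := draw_gram R p d M n n1 g X y (W l w).
(* [S] is the matrix that [U] decomposes at every outcome; [S'] is its truncated copy, almost surely
   equal to it, for which the moments are computed. *)
pose S w : 'M[R]_p := L%:R^-1 *: \sum_l (sel l w *m (sel l w)^T).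
pose S' w : 'M[R]_p := L%:R^-1 *: \sum_l G l w.
have Wlaw l l' A : measurable A -> P (W l @^-1` A) = P (W l' @^-1` A).
  move=> mA; apply: draw_eq_law => // [m B mB|C]; first by rewrite !hProj_law.
  by apply: (uniform_subset_law _ _ _ _ _ _ _ _ n1n (mN l) (mN l')) => T; exact: hNsub_law.
have bG l i j : bmeas (fun w => G l w i j).
  have [mg [c gc]] := bmeas_draw_gram R p d M n n1 g X y hg i j.
  by split; [exact: (measurableT_comp mg)|exists c => w; exact: gc].
have msel l i j : measurable_fun setT (fun w => (sel l w *m (sel l w)^T) i j).
  exact: (measurableT_comp (measurable_draw_select R p d M n n1 g X y hg i j)).
have good : \forall w \ae P, forall l, draw_good R p d M n (W l w).
  apply: filter_forall => l.
  suff: \forall w \ae P, forall m, unit_cols R p d (Proj l m w).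
    by apply: filterS => w gw; exact/draw_goodP.
  apply: filter_forall => m; have mU := measurable_unit_cols R p d.
  have mPU : measurable (Proj l m @^-1` [set A | unit_cols R p d A]).
    by rewrite -[_ @^-1` _]setTI; exact: (hProj_meas l m).
  exists (~` (Proj l m @^-1` [set A | unit_cols R p d A])).
  split; [exact: measurableC| |by []].
  by rewrite probability_setC // hProj_law // hQ subee.
have GE : \forall w \ae P, forall l, G l w = sel l w *m (sel l w)^T.
  by apply: filterS good => w gw l; rewrite /G /draw_gram gw.
(* Equality in law moves group [l] to the group [l0] that defines [Piinf]; there the truncation
   changes a null set only. *)
have EG l i j : \int[P]_w G l w i j = Piinf i j.
  have bg := bmeas_draw_gram R p d M n n1 g X y hg i j.
  rewrite (eq_law_Rintegral _ _ _ _ _ _ (W l) (W l0) _ bg (Wlaw l l0)) mxE unlock.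
  congr fine; apply: ae_eq_integral => //.
  - by apply/measurable_EFinP; case: (bG l0 i j).
  - by apply/measurable_EFinP; exact: msel.
  - by apply: filterS GE => w /= Gw _; rewrite -/(G l0 w) Gw.
have EGG l l' i j : l != l' ->
    \int[P]_w (G l w i j * G l' w i j) = Piinf i j ^+ 2.
  move=> ll'; have bg := bmeas_draw_gram R p d M n n1 g X y hg i j.
  rewrite expr2 -{1}(EG l) -(EG l').
  apply: (Rintegral_mulr_indep _ _ _ _ _ _ _ _ (W l) (W l') _ _ _ bg bg).
  exact: draw_indep.
have [bF EF] := Rintegral_frobnorm_mean _ _ _ P L p G Piinf d%:R hL bG EG EGG
  (fun l w => frobnorm_draw_gram _ _ _ _ _ _ _ _ _ (W l w)).
have PiT : Piinf^T = Piinf.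
  apply/matrixP => i j; rewrite [LHS]mxE [LHS]mxE [RHS]mxE; congr fine.
  congr ('E_P[_])%E; apply/funext => w; set A := select_proj _ _ _ _ _ _.
  by transitivity ((A *m A^T)^T i j); [rewrite [RHS]mxE|rewrite trmx_mul trmxK].
pose K := 2 * Num.sqrt d0%:R * opnorm R p p (Piinf - A0 *m A0^T).
have dFle w : dF R p d0 (U w *m pid_mx d0) A0 <=
    K + Num.sqrt 2 * frobnorm R p p (S w - Piinf).
  by apply: (dF_svd_le _ _ _ (S w) Piinf (U w) A0 hd0p _ hA0 PiT); exact: (hU w).
have sL : 0 < Num.sqrt (L%:R : R) by rewrite sqrtr_gt0 ltr0n.
(* [c ^+ 2] is the second-moment bound of [EF]. As the weight in the AM-GM inequality below it makes
   both halves equal to [Num.sqrt 2 * c / 2]. *)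
pose c : R := d%:R / Num.sqrt L%:R.
have c0 : 0 < c by rewrite divr_gt0 // ltr0n.
pose k1 : R := Num.sqrt 2 / (2 * c).
pose k0 : R := K + Num.sqrt 2 * c / 2.
pose h w := k0 + k1 * frobnorm R p p (S w - Piinf) ^+ 2.
pose h' w := k0 + k1 * frobnorm R p p (S' w - Piinf) ^+ 2.
have hle w : dF R p d0 (U w *m pid_mx d0) A0 <= h w.
  apply: le_trans (dFle w) _; rewrite /h /k0 /k1 -addrA lerD2l.
  set x := frobnorm _ _ _ _.
  rewrite -subr_ge0.
  (* AM-GM: [x <= (x ^+ 2 / c + c) / 2] avoids taking the expectation of a square root. *)
  have -> : Num.sqrt 2 * c / 2 + Num.sqrt 2 / (2 * c) * x ^+ 2 - Num.sqrt 2 * x =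
      Num.sqrt 2 / (2 * c) * (x - c) ^+ 2 by field; rewrite gt_eqF.
  by rewrite mulr_ge0 ?sqr_ge0 // divr_ge0 ?sqrtr_ge0 // mulr_ge0 // ltW.
apply: le_trans (ge0_le_expectation_nonmeasurable _ _ _ P _ h _ hle) _.
  by move=> w; exact: sqrtr_ge0.
have bh' : bmeas h'.
  by apply: bmeasD; [exact: bmeas_cst|apply: bmeasM => //; exact: bmeas_cst].
have mh : measurable_fun setT h.
  apply: measurable_funD; first exact: measurable_cst.
  apply: measurable_funM; first exact: measurable_cst.
  under eq_fun do rewrite sqr_frobnorm mxtrace_trmulE.
  apply: measurable_sum => i; apply: measurable_sum => j.
  suff mS : measurable_fun setT (fun w => (S w - Piinf) i j) by exact: measurable_funM.
  under eq_fun do rewrite !mxE summxE.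
  apply: measurable_funB; last exact: measurable_cst.
  apply: measurable_funM; first exact: measurable_cst.
  by apply: measurable_sum => l; exact: msel.
have -> : ('E_P[h] = (\int[P]_w h' w)%R%:E)%E.
  rewrite unlock /Rintegral fineK; last first.
    by apply: integrable_fin_num => //; exact: bmeas_integrable.
  apply: ae_eq_integral => //.
  - exact/measurable_EFinP.
  - by apply/measurable_EFinP; case: bh'.
  - apply: filterS GE => w Gw _; congr (_ + _ * frobnorm _ _ _ (_ *: _ - _) ^+ 2)%:E.
    by apply: eq_bigr => l _; rewrite Gw.
rewrite lee_fin RintegralD //; last 2 first.
- by apply: bmeas_integrable; exact: bmeas_cst.
- by apply: bmeas_integrable; apply: bmeasM => //; exact: bmeas_cst.
rewrite Rintegral_prob_cst RintegralZl //; last exact: bmeas_integrable.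
have k1_ge0 : 0 <= k1 by rewrite divr_ge0 ?sqrtr_ge0 // mulr_ge0 // ltW.
apply: le_trans (_ : k0 + k1 * c ^+ 2 <= _).
  rewrite lerD2l ler_wpM2l // (le_trans EF) // /c expr_div_n sqr_sqrtr ?ler0n //.
rewrite /k0 -addrA lerD2l.
have -> : Num.sqrt 2 * c / 2 + k1 * c ^+ 2 = Num.sqrt 2 * d%:R / Num.sqrt L%:R.
  rewrite /k1 -[RHS]mulrA -/c; field; rewrite gt_eqF //.
rewrite ler_wpM2r ?invr_ge0 ?sqrtr_ge0 //.
(* The constants are compared factor by factor: [d <= p], [1 <= 2 * Num.sqrt d0%:R] and
   [2 <= 2 * pi]. *)
apply: ler_pM; rewrite ?sqrtr_ge0 ?ler0n // ?ler_nat //.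
rewrite -[leLHS]mul1r; apply: ler_pM; rewrite ?sqrtr_ge0 //.
  apply: le_trans (_ : 2 * 1 <= _); first by rewrite mulr1 ler1n.
  by rewrite ler_wpM2l // -[leLHS]sqrtr1 ler_sqrt ?ler1n ?ler0n.
rewrite ler_sqrt ?mulr_ge0 ?pi_ge0 //.
rewrite -[leLHS]mulr1 ler_wpM2l // (le_trans _ (pi_ge2 R)) // ler1n //.
Qed.
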